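(* Let $B\in\mathbb{C}\setminus\{0\}$ and consider the rational difference equation $$z_{n+1}=\frac{z_{n}}{1+Bz_{n-1}-Bz_{n}},\quad n=0,1,\dots,$$ with initial conditions $z_{0},z_{-1}\in\mathbb{C}$. Then its forbidden set $\mathfrak{F}$ (a set of pairs $(z_0,z_{-1})$) equals $$S_{1}=\left\{\left(0,\tfrac{-1}{B}\right)\right\}\cup\left\{\left(\tfrac{-1}{B}\cdot\tfrac{n+1}{n},\tfrac{-1}{B}\right)\,\middle|\,n\in\mathbb{N}\right\}\cup\left\{\left(\tfrac{-1}{B},\tfrac{-1}{B}\cdot\tfrac{n+1}{n}\right)\,\middle|\,n\in\mathbb{N}\right\}$$ $$\cup\bigcup_{D\in\mathbb{C}\setminus[0,4]}\left\{\left(a,\frac{DBa-Ba-1}{B^{2}a+B}\right)\,\middle|\,a\in P_D\setminus\left\{0,\tfrac{-1}{B}\right\}\right\}\cup\bigcup_{D\in(0,4)}\left\{\left(a,\frac{DBa-Ba-1}{B^{2}a+B}\right)\,\middle|\,a\in Q_D\setminus\left\{0,\tfrac{-1}{B}\right\}\right\}$$ $$\cup\left\{\left(a,\frac{3Ba-1}{B^{2}a+B}\right)\,\middle|\,a\in\left\{\tfrac{-2}{B}\cdot\tfrac{n-1}{n}+\tfrac{3}{B}\,\middle|\,n\in\mathbb{N}\right\}\setminus\left\{0,\tfrac{-1}{B}\right\}\right\},$$ where $$P_D=\left\{\frac{-2}{B}\left(\frac{\left(1+\sqrt{1-\frac{4}{D}}\right)^{n-1}-\left(1-\sqrt{1-\frac{4}{D}}\right)^{n-1}}{\left(1+\sqrt{1-\frac{4}{D}}\right)^{n}-\left(1-\sqrt{1-\frac{4}{D}}\right)^{n}}\right)+\frac{D-1}{B}\,\middle|\,n\in\mathbb{N}\right\},$$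 $$Q_D=\left\{\frac{-D}{2B}\left(1-\sqrt{\tfrac{4}{D}-1}\,\cot\left(n\arccos\left(\tfrac{\sqrt{D}}{2}\right)\right)\right)+\frac{D-1}{B}\,\middle|\,n\in\mathbb{N},\ n\arccos\left(\tfrac{\sqrt D}{2}\right)\notin\pi\mathbb{Z}\right\}.$$ Moreover, given $(z_{0},z_{-1})\notin\mathfrak{F}$, there are four possibilities: (i) $z_{0}=0$, in which case $z_{n}=0$ for all $n\geq 0$. (ii) $z_{0}\neq 0$ and $z_{-1}=\frac{-1}{B}$, in which case $z_{2n+1}=\frac{-1}{B}$ for all $n\geq 0$ and $z_{2n}=\frac{-1}{2B+B^{2}z_{2n-2}}$ for all $n\geq 1$. Thus $$z_{2n}=\frac{n+2+nBz_{0}+Bz_{0}}{nB+B+nB^{2}z_{0}}-\frac{2}{B},\quad n\geq 0.$$ (iii) $z_{0}=\frac{-1}{B}$, in which case $z_{2n}=\frac{-1}{B}$ for all $n\geq 0$ and $z_{2n+1}=\frac{-1}{2B+B^{2}z_{2n-1}}$ for all $n\geq 0$. Thus $$z_{2n+1}=\frac{n+3+nBz_{-1}+2Bz_{-1}}{nB+2B+nB^{2}z_{-1}+B^{2}z_{-1}}-\frac{2}{B},\quad n\geq -1.$$ (iv) $z_{0}\neq 0,\frac{-1}{B}$ and $z_{-1}\neq\frac{-1}{B}$, in which case $z_{n+1}=\frac{1+Bz_{n}}{C-B-B^{2}z_{n}}$ for all $n\geq 0$, where $C=\left(\frac{1}{z_{0}}+B\right)\left(1+Bz_{-1}\right)$.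 This implies the following: (a) If $\frac{B}{C}\in\mathbb{C}\setminus\left[\frac14,\infty\right)$, then with $\lambda_{1}=\frac{1-\sqrt{1-\frac{4B}{C}}}{2}$, $\lambda_{2}=\frac{1+\sqrt{1-\frac{4B}{C}}}{2}$, $M_{1}=C-B-B^{2}z_{0}-C\lambda_{1}$ and $M_{2}=C\lambda_{2}+B+B^{2}z_{0}-C$, $$z_{n}=\frac{-C}{B^{2}}\left(\frac{M_{2}\lambda_{1}^{n+1}+M_{1}\lambda_{2}^{n+1}}{M_{2}\lambda_{1}^{n}+M_{1}\lambda_{2}^{n}}\right)+\frac{C}{B^{2}}-\frac{1}{B},\quad n\geq 0.$$ (b) If $C=4B$, then $$z_{n}=\frac{4+(n+1)(2-2Bz_{0})}{nB^{2}z_{0}-2B-nB}+\frac{3}{B},\quad n\geq 0.$$ (c) If $\frac{C}{B}\in(0,4)$, then with $\rho=\arccos\left(\sqrt{\frac{C}{4B}}\right)$ and $w_{0}=\frac{-B^{2}z_{0}+C-B}{C}$, for all $n\geq 0$, $$z_{n}=\frac{-\sqrt{\frac{C}{B}}}{B}\left(\frac{\sqrt{\frac{4B}{C}-1}\,\cos((n+1)\rho)+(2w_{0}-1)\sin((n+1)\rho)}{\sqrt{\frac{4B}{C}-1}\,\cos(n\rho)+(2w_{0}-1)\sin(n\rho)}\right)+\frac{C-B}{B^{2}}.$$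
   Context: The forbidden set $\mathfrak{F}$ of a second order rational difference equation is the set of initial conditions, written as pairs $(z_{0},z_{-1})\in\mathbb{C}^{2}$ in this order, for which the iteration eventually requires a division by zero (so that $z_n$ is not well defined for some $n\ge 1$; $0/0$ counts as undefined). $\mathbb{N}=\{1,2,3,\dots\}$. $\sqrt{\cdot}$ is the principal complex square root, with branch cut along the negative real numbers; $\arccos$ is the usual real arccosine. *)

(* Defs.v *)
(* The complex numbers are R[i] for R : realType; sqrtc is the principal
   square root: nonnegative real part, and i * sqrt(-x) on the negative axis. *)
From mathcomp Require Import all_boot all_order all_algebra.
From mathcomp Require Import all_classical all_reals all_analysis.
From mathcomp Require Import complex.

Set Implicit Arguments.
Unset Strict Implicit.
Unset Printing Implicit Defensive.

Import Order.TTheory GRing.Theory Num.Theory.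

Local Open Scope classical_set_scope.
Local Open Scope ring_scope.
Local Open Scope complex_scope.

(* A subset of R seen as a subset of the real axis of R[i]. *)
Definition real_axis (R : realType) (I : set R) : set R[i] :=
  [set t%:C | t in I].

Definition cot (R : realType) (x : R) : R := cos x / sin x.

(* A state is the pair (z_n, z_{n-1}), in this order; None means undefined. *)
Definition step (R : realType) (B : R[i]) (p : R[i] * R[i]) :
    option (R[i] * R[i]) :=
  let den := 1 + B * p.2 - B * p.1 in
  if den == 0 then None else Some (p.1 / den, p.1).

Definition state (R : realType) (B : R[i]) (p : R[i] * R[i]) (n : nat) :
    option (R[i] * R[i]) :=
  iter n (obind (step B)) (Some p).

Definition forbidden (R : realType) (B : R[i]) : set (R[i] * R[i]) :=
  [set p | exists n : nat, state B p n = None].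

(* The solution z_k, k >= -1, with (z_0, z_{-1}) = p. The value 0 given when
   the iteration breaks down, and the value p.2 given for k < -1, are junk. *)
Definition solution (R : realType) (B : R[i]) (p : R[i] * R[i]) (k : int) :
    R[i] :=
  match k with
  | Posz n => if state B p n is Some (x, _) then x else 0
  | Negz _ => p.2
  end.

Definition P_set (R : realType) (B D : R[i]) : set R[i] :=
  let s := sqrtc (1 - 4 / D) in
  [set - 2 / B * (((1 + s) ^+ (n - 1) - (1 - s) ^+ (n - 1)) /
                  ((1 + s) ^+ n - (1 - s) ^+ n))
       + (D - 1) / B
   | n in [set n : nat | (1 <= n)%N]].

Definition Q_set (R : realType) (B : R[i]) (D : R) : set R[i] :=
  let rho := acos (Num.sqrt D / 2) in
  [set - D%:C / (2 * B) *
         (1 - (Num.sqrt (4 / D - 1))%:C * (cot (n%:R * rho))%:C)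
       + (D%:C - 1) / B
   | n in [set n : nat | (1 <= n)%N /\
                         ~ exists k : int, n%:R * rho = k%:~R * pi]].

Definition S1 (R : realType) (B : R[i]) : set (R[i] * R[i]) :=
  [set (0, - 1 / B)]
  `|` [set (- 1 / B * (n.+1%:R / n%:R), - 1 / B)
       | n in [set n : nat | (1 <= n)%N]]
  `|` [set (- 1 / B, - 1 / B * (n.+1%:R / n%:R))
       | n in [set n : nat | (1 <= n)%N]]
  `|` \bigcup_(D in ~` real_axis `[0, 4])
        [set (a, (D * B * a - B * a - 1) / (B ^+ 2 * a + B))
         | a in P_set B D `\` [set 0; - 1 / B]]
  `|` \bigcup_(D in (`]0, 4[ : set R))
        [set (a, (D%:C * B * a - B * a - 1) / (B ^+ 2 * a + B))
         | a in Q_set B D `\` [set 0; - 1 / B]]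
  `|` [set (a, (3 * B * a - 1) / (B ^+ 2 * a + B))
       | a in [set - 2 / B * ((n%:R - 1) / n%:R) + 3 / B
               | n in [set n : nat | (1 <= n)%N]] `\` [set 0; - 1 / B]].

(* Main.v *)
Require Import Defs.
From mathcomp Require Import all_boot all_order all_algebra.
From mathcomp Require Import all_classical all_reals all_analysis.
From mathcomp Require Import complex ring lra zify.
Import Order.TTheory GRing.Theory Num.Theory.
Local Open Scope classical_set_scope.
Local Open Scope ring_scope.
Local Open Scope complex_scope.

(** Put u_n = B z_{n-1}, so that the denominator of the n-th step is
    1 + u_n - u_{n+1}.  The theorem holds because the map linearises.  Every
    orbit with z_0 <> 0 can be written u_n = c T_n / T_{n+2}, where the sequence
    T satisfies the bilinear identity
      T_{n+1} T_{n+4} = T_{n+2} T_{n+3} + c (T_n T_{n+3} - T_{n+1} T_{n+2}).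
    This identity says exactly that the denominator of the n-th step is
    T_{n+1} T_{n+4} / (T_{n+2} T_{n+3}), and then the step itself is a
    cancellation.  Hence the iteration breaks down at the first zero among
    T_4, T_5, ..., and otherwise z_n is a quotient of two values of T
    ([tau_forbidden_solution]).

    The quantity D = (1 + B z_n) (1 + B z_{n-1}) / (B z_n) is constant along an
    orbit (C = D B in the statement), and it tells which T to take.

    If D <> 0, then c = 1/D and T is a solution of the linear recurrence
    T_{n+2} = T_{n+1} - T_n / D ([generic_orbit]).  In terms of the fundamental
    solution U (U_0 = 0, U_1 = 1) one has T_{n+4} = w U_{n+1} - U_n / D, where
    w = (D - 1 - B z_0) / D.  Two consecutive terms of U never both vanish, so a
    zero means U_{n+1} <> 0 and B z_0 = D - 1 - U_n / U_{n+1}: this is the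
    condition [breakdown].  It remains to solve the recurrence, whose
    characteristic equation is l^2 = l - 1/D.
    - For D outside [0, 4] the roots (1 +- s)/2, s^2 = 1 - 4/D, have distinct
      moduli, so no U_{n+1} vanishes, and one gets the sets P_D.
    - For D in (0, 4) the roots are conjugate and U_n is proportional to
      sin (n rho) / sqrt(D)^n with cos rho = sqrt(D)/2, which gives Q_D.
    - For D = 4 the root 1/2 is double and U_n is proportional to n / 2^n.
    The closed forms of z_n come from the same three families of solutions,
    since only ratios T_{n+1} / T_n matter.

    If D = 0, one of z_0, z_{-1} equals -1/B, this value recurs at every other
    step, and with c = -1 the sequence T is constant on one parity class and an
    arithmetic progression on the other ([interlaced]).

    The case z_0 = 0 is immediate. *)

(** * Two-term linear recurrences *)

(** The solution of f_{n+2} = f_{n+1} - c f_n with f_0 = a and f_1 = b.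
    Recursion on the pair of initial values keeps it structural. *)
Fixpoint linrec (F : fieldType) (c a b : F) (n : nat) : F :=
  if n is m.+1 then linrec F c b (b - c * a) m else a.
Arguments linrec {F} c a b n.

Lemma linrecSS (F : fieldType) (c a b : F) n :
  linrec c a b n.+2 = linrec c a b n.+1 - c * linrec c a b n.
Proof. by elim: n a b => [|n IHn] a b //; apply: IHn. Qed.

Lemma linrec_eq (F : fieldType) (c : F) (f : nat -> F) :
  (forall n, f n.+2 = f n.+1 - c * f n) ->
  forall n, f n = linrec c (f 0%N) (f 1%N) n.
Proof.
move=> frec n; suff [] : f n = linrec c (f 0%N) (f 1%N) n /\
  f n.+1 = linrec c (f 0%N) (f 1%N) n.+1 by [].
elim: n => [//|n [IH0 IH1]]; split=> //.
by rewrite linrecSS frec IH0 IH1.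
Qed.

Lemma linrecZ (F : fieldType) (c k a b : F) n :
  linrec c (k * a) (k * b) n = k * linrec c a b n.
Proof.
rewrite -(linrec_eq _ c (fun n => k * linrec c a b n)) // => {}n.
by rewrite linrecSS; ring.
Qed.

(** Both sides solve the same recurrence from the same initial values; the right
    side isolates the dependence on w, so that y_{n+1} = 0 can be solved for w. *)
Lemma linrec_fundamental (F : fieldType) (c w : F) n :
  linrec c 1 w n.+1 = w * linrec c 0 1 n.+1 - c * linrec c 0 1 n.
Proof.
suff [] : linrec c 1 w n.+1 = w * linrec c 0 1 n.+1 - c * linrec c 0 1 n /\
  linrec c 1 w n.+2 = w * linrec c 0 1 n.+2 - c * linrec c 0 1 n.+1 by [].
elim: n => [|n [IH0 IH1]]; first by split=> /=; ring.
by split=> //; rewrite (linrecSS _ _ _ _ n.+1) IH0 IH1 !linrecSS; ring.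
Qed.

(** As c <> 0, the recurrence can be run backwards: two consecutive zeros would
    force U_1 = 0. *)
Lemma linrec01_neq0 (F : fieldType) (c : F) n :
  c != 0 -> linrec c 0 1 n.+1 = 0 -> linrec c 0 1 n != 0.
Proof.
move=> c0; elim: n => [/= /eqP|n IHn]; first by rewrite oner_eq0.
rewrite linrecSS => U2; apply/eqP => U1; move/eqP: U2.
rewrite U1 sub0r oppr_eq0 mulf_eq0 (negbTE c0) /=.
exact/negP/IHn.
Qed.

(** A zero y_{n+1} = w U_{n+1} - c U_n forces U_{n+1} <> 0, because otherwise
    U_n = 0 as well; so w can be recovered from it. *)
Lemma linrec_zero (F : fieldType) (c w : F) : c != 0 ->
  (exists n, linrec c 1 w n.+1 = 0) <->
  (exists n, linrec c 0 1 n.+1 != 0 /\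
             w = c * (linrec c 0 1 n / linrec c 0 1 n.+1)).
Proof.
move=> c0; split=> -[n]; last first.
  by case=> U0 ->; exists n; rewrite linrec_fundamental; field.
rewrite linrec_fundamental => yn; exists n.
have U0 : linrec c 0 1 n.+1 != 0.
  apply/eqP => Un; move/eqP: yn.
  rewrite Un mulr0 sub0r oppr_eq0 mulf_eq0 (negbTE c0) /=.
  exact/negP/linrec01_neq0.
by split=> //; rewrite mulrA -(subr0_eq yn) mulfK.
Qed.

(** Ratios of consecutive terms do not see a scalar factor, so any solution with
    the right initial ratio can stand for [linrec c 1 _]: the closed forms below
    need not be normalised. *)
Lemma linrec_ratio (F : fieldType) (c : F) (f : nat -> F) :
  f 0%N != 0 -> (forall n, f n.+2 = f n.+1 - c * f n) ->
  forall n, f n.+1 / f n =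
    linrec c 1 (f 1%N / f 0%N) n.+1 / linrec c 1 (f 1%N / f 0%N) n.
Proof.
move=> f0 frec n.
have fE m : f m = f 0%N * linrec c 1 (f 1%N / f 0%N) m.
  by rewrite (linrec_eq _ _ _ frec m) -linrecZ mulr1 mulrC divfK.
by rewrite (fE n.+1) (fE n) -mulf_div divff // mul1r.
Qed.

Lemma linrec01_ratio (F : fieldType) (c : F) (f : nat -> F) :
  f 0%N = 0 -> f 1%N != 0 -> (forall n, f n.+2 = f n.+1 - c * f n) ->
  forall n, (linrec c 0 1 n.+1 == 0) = (f n.+1 == 0) /\
            linrec c 0 1 n / linrec c 0 1 n.+1 = f n / f n.+1.
Proof.
move=> f0 f1 frec n.
have fE m : f m = f 1%N * linrec c 0 1 m.
  by rewrite (linrec_eq _ _ _ frec m) -linrecZ mulr1 mulr0 f0.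
by rewrite (fE n.+1) (fE n) -mulf_div divff // mul1r mulf_eq0 (negbTE f1).
Qed.

(** * Solutions of the recurrence by the nature of the roots *)
Lemma root_pair_rec (F : fieldType) (c l1 l2 a b : F) :
  l1 ^+ 2 = l1 - c -> l2 ^+ 2 = l2 - c ->
  let f n := a * l1 ^+ n + b * l2 ^+ n in
  forall n, f n.+2 = f n.+1 - c * f n.
Proof.
move=> h1 h2 f n; rewrite /f -(addn2 n) !exprD h1 h2 !exprS; ring.
Qed.

(** For c = 1/4 the characteristic root 1/2 is double. *)
Lemma double_root_rec (F : numFieldType) (a b : F) :
  let f n := (a + b * n%:R) / 2 ^+ n in
  forall n, f n.+2 = f n.+1 - 4^-1 * f n.
Proof.
move=> f n; rewrite /f !exprS; field.
by rewrite expf_neq0 // pnatr_eq0.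
Qed.

(** The points equidistant from 1 and -1 form the imaginary axis, where squares
    are nonpositive reals. *)
Lemma norm_add1_sub1 (R : realType) (s : R[i]) :
  `|1 + s| = `|1 - s| -> exists t : R, 0 <= t /\ s ^+ 2 = - t%:C.
Proof.
case: s => x y /(congr1 (fun z => z ^+ 2)).
rewrite -!add_Re2_Im2 /= => /complexI h.
have x0 : x = 0 by nra.
exists (y ^+ 2); split; first exact: sqr_ge0.
by rewrite x0; apply/eqP; rewrite eq_complex /=; apply/andP; split; apply/eqP; ring.
Qed.

(** Equal powers would give 1 + s and 1 - s the same modulus, hence
    1 - 4/D = - t with t >= 0, and D = 4 / (1 + t) would lie in [0, 4]. *)
Lemma expr_add1_sub1 (R : realType) (D s : R[i]) n :
  ~ real_axis `[0, 4] D -> s ^+ 2 = 1 - 4 / D ->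
  (1 + s) ^+ n.+1 - (1 - s) ^+ n.+1 != 0.
Proof.
move=> nD sE; apply/eqP => /subr0_eq /(congr1 Num.norm).
rewrite !normrX => /eqP; rewrite eqrXn2 // => /eqP /norm_add1_sub1 [t [t0]].
rewrite sE => h.
have D0 : D != 0.
  by apply/eqP => D0; apply: nD; rewrite D0; exists 0; rewrite //= in_itv /=; lra.
have t1 : (1 + t)%:C != 0 :> R[i] by rewrite fmorph_eq0 gt_eqF // ltr_pwDl.
apply: nD; exists (4 / (1 + t)).
  rewrite /= in_itv /= divr_ge0 ?addr_ge0 //= ler_pdivrMr; nra.
rewrite fmorph_div rmorph_nat; apply: (mulIf t1); rewrite divfK //.
rewrite rmorphD rmorph1 /= -[t%:C]opprK -h; field.
exact: D0.
Qed.

Lemma sin_int_pi (R : realType) (k : int) : sin (k%:~R * pi) = 0 :> R.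
Proof.
have nat_case (n : nat) : sin (n%:R * pi) = 0 :> R.
  elim: n => [|n IHn]; first by rewrite mul0r sin0.
  by rewrite -natr1 mulrDl mul1r sinDpi IHn oppr0.
by case: k => n; rewrite ?NegzE ?mulrNz ?mulNr ?sinN -pmulrn nat_case ?oppr0.
Qed.

(** Reduce x modulo pi by the floor of x / pi; the sine is positive inside
    (0, pi). *)
Lemma sin_eq0 (R : realType) (x : R) :
  sin x = 0 <-> exists k : int, x = k%:~R * pi.
Proof.
split=> [sx|[k ->]]; last exact: sin_int_pi.
have pi0 := pi_gt0 R; pose k := Num.floor (x / pi); exists k.
have [lo hi] : k%:~R * pi <= x /\ x < (k + 1)%:~R * pi.
  by rewrite -ler_pdivlMr // -ltr_pdivrMr // floor_le_tmp floorD1_gt.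
apply/eqP; rewrite eq_le lo andbT leNgt; apply/negP => kx.
have : sin (x - k%:~R * pi) = 0 by rewrite sinB sx sin_int_pi; ring.
apply/eqP; rewrite gt_eqF // sin_gt0_pi //.
by rewrite intrD mulrDl mul1r in hi; apply/andP; split; lra.
Qed.

Lemma sin_rec (R : realType) (rho : R) n :
  sin (n.+2%:R * rho) = 2 * cos rho * sin (n.+1%:R * rho) - sin (n%:R * rho).
Proof.
have -> : n.+2%:R * rho = n.+1%:R * rho + rho by ring.
have -> : n%:R * rho = n.+1%:R * rho - rho by ring.
by rewrite sinD sinB; ring.
Qed.

Lemma cos_rec (R : realType) (rho : R) n :
  cos (n.+2%:R * rho) = 2 * cos rho * cos (n.+1%:R * rho) - cos (n%:R * rho).
Proof.
have -> : n.+2%:R * rho = n.+1%:R * rho + rho by ring.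
have -> : n%:R * rho = n.+1%:R * rho - rho by ring.
by rewrite cosD cosB; ring.
Qed.

(** The second equation is tan rho = sqrt(4/t - 1). *)
Lemma cos_acos_sqrt (R : realType) (t : R) : 0 < t < 4 ->
  let rho := acos (Num.sqrt t / 2) in
  cos rho = Num.sqrt t / 2 /\ sin rho = cos rho * Num.sqrt (4 / t - 1).
Proof.
move=> /andP[t0 t4] rho.
have s0 : 0 < Num.sqrt t by rewrite sqrtr_gt0.
have s2 : Num.sqrt t ^+ 2 = t by rewrite sqr_sqrtr // ltW.
have s_lt2 : Num.sqrt t < 2 by nra.
have s_in : -1 <= Num.sqrt t / 2 <= 1 by apply/andP; split; lra.
have cosE : cos rho = Num.sqrt t / 2 by rewrite acosK // in_itv.
split=> //; rewrite sin_acos // cosE.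
rewrite -[Num.sqrt t / 2]ger0_norm; last by lra.
rewrite -sqrtr_sqr -sqrtrM ?sqr_ge0 //; congr Num.sqrt.
rewrite sqrtr_sqr ger0_norm; last by lra.
by rewrite !expr_div_n s2; field; rewrite gt_eqF.
Qed.

(** The roots are exp(+- i rho) / sqrt(t) because 2 cos rho = sqrt(t); the
    addition formulas give the recurrence without complex exponentials. *)
Lemma trig_rec (R : realType) (t : R) (a b : R[i]) : 0 < t < 4 ->
  let rho := acos (Num.sqrt t / 2) in
  let f (n : nat) := (a * (cos (n%:R * rho))%:C + b * (sin (n%:R * rho))%:C) /
                     (Num.sqrt t)%:C ^+ n in
  forall n, f n.+2 = f n.+1 - t%:C^-1 * f n.
Proof.
move=> t04 rho f n; have [cosE _] := cos_acos_sqrt _ _ t04.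
have /andP[t0 t4] := t04.
have s0 : (Num.sqrt t)%:C != 0 :> R[i].
  by rewrite fmorph_eq0 gt_eqF // sqrtr_gt0.
have tE : t%:C = (Num.sqrt t)%:C ^+ 2 :> R[i] by rewrite -rmorphXn /= sqr_sqrtr // ltW.
rewrite /f sin_rec cos_rec -/rho cosE tE !rmorphB !rmorphM /= !exprS.
rewrite fmorphV !rmorph_nat.
by field; rewrite expf_neq0.
Qed.

(** * Orbits in bilinear form *)

(** The bilinear identity is the factorisation of the denominator
    1 + u_n - u_{n+1} as T_{n+1} T_{n+4} / (T_{n+2} T_{n+3}).  As long as the
    earlier terms are nonzero, a step is therefore undefined exactly when
    T_{n+4} = 0, and otherwise it replaces u_{n+1} = c T_{n+1} / T_{n+3} by
    c T_{n+2} / T_{n+4}. *)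
Lemma tau_forbidden_solution (R : realType) (B : R[i]) (hB : B != 0)
    (p : R[i] * R[i]) (c : R[i]) (T : nat -> R[i]) :
  T 1%N != 0 -> T 2%N != 0 -> T 3%N != 0 ->
  B * p.2 = c * (T 0%N / T 2%N) -> B * p.1 = c * (T 1%N / T 3%N) ->
  (forall n, T n.+1 * T n.+4 =
     T n.+2 * T n.+3 + c * (T n * T n.+3 - T n.+1 * T n.+2)) ->
  (forbidden B p <-> exists n, T n.+4 = 0) /\
  (~ forbidden B p -> forall n,
     T n.+3 != 0 /\ solution B p n%:Z = c * (T n.+1 / T n.+3) / B).
Proof.
move=> T1 T2 T3 p2 p1 bilin.
(* x n is z_{n-1}: the state after n steps is (x n.+1, x n). *)
pose x n := c * (T n / T n.+2) / B.
have xE n : B * x n = c * (T n / T n.+2) by rewrite /x mulrC divfK.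
have denE n : T n.+2 != 0 -> T n.+3 != 0 ->
    1 + B * x n - B * x n.+1 = T n.+1 * T n.+4 / (T n.+2 * T n.+3).
  by move=> ? ?; rewrite !xE bilin; field; apply/andP.
have stateE n : (forall k, (k <= n)%N -> T k.+3 != 0) ->
    state B p n = Some (x n.+1, x n).
  elim: n => [_|n IHn Tn].
    by rewrite /state /=; case: p p1 p2 => a b /= p2 p1; congr Some;
      congr (_, _); apply: (mulfI hB); rewrite xE.
  have nz k : (k <= n.+4)%N -> (0 < k)%N -> T k != 0.
    case: k => [|[|[|[|k]]]] // kn _; exact: (Tn k.+1).
  have [nz1 nz2 nz3 nz4] : [/\ T n.+1 != 0, T n.+2 != 0, T n.+3 != 0 & T n.+4 != 0].
    by split; apply: nz; rewrite // ?ltnS ?leqW.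
  rewrite /state iterS -/(state B p n) IHn; last by move=> k kn; apply/Tn/ltnW.
  rewrite /= /step /= denE // ifN; last first.
    by apply: mulf_neq0; rewrite ?invr_eq0 mulf_neq0.
  by congr (Some (_, _)); rewrite /x; field; rewrite hB nz1 nz2 nz3 nz4.
have prefix : (exists n, T n.+4 = 0) -> forbidden B p.
  case=> m Tm; have exT : exists n, T n.+4 == 0 by exists m; apply/eqP.
  (* The first zero is reached by defined steps, since all earlier terms are
     nonzero. *)
  case: (ex_minnP exT) => n /eqP Tn nmin; exists n.+1.
  have nz k : (k < n)%N -> T k.+4 != 0.
    by move=> kn; apply: contraL (kn) => /nmin; rewrite -leqNgt.
  have nz3 k : (k < n.+4)%N -> (0 < k)%N -> T k != 0.
    by case: k => [|[|[|[|k]]]] // kn _; apply: nz.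
  rewrite /state iterS -/(state B p n) stateE; last first.
    by move=> [|k] kn //; apply: nz.
  have [nz1 nz2] : T n.+2 != 0 /\ T n.+3 != 0 by split; apply: nz3.
  by rewrite /= /step /= denE // Tn mulr0 mul0r eqxx.
have noprefix : ~ (exists n, T n.+4 = 0) -> forall n, T n.+3 != 0.
  by move=> nT [|n] //; apply/eqP => Tn; apply: nT; exists n.
split.
  split=> // -[n]; apply: contraPP => /noprefix nz.
  by rewrite stateE.
move=> nF n; have nz : forall n, T n.+3 != 0.
  by apply: noprefix => /prefix.
by split=> //; rewrite /solution stateE.
Qed.

Lemma add1_eq0 (R : realType) (B z : R[i]) (hB : B != 0) :
  (1 + B * z == 0) = (z == - 1 / B).
Proof.
apply/eqP/eqP => [h|->]; last by field.
by apply: (mulfI hB); rewrite -[LHS]add0r -{1}(subrr 1) addrAC h; field.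
Qed.

(** * Orbits through the exceptional value -1/B *)

(** The value 1 is taken on the indices of parity b.  On the other indices the
    progression is normalised so that its term of rank 1 is 1, whatever a is;
    with c = -1 its term of rank 0 encodes the free initial condition. *)
Definition interlaced (F : fieldType) (b : bool) (a : F) (n : nat) : F :=
  if odd n == b then 1 else a + n./2%:R * (1 - a).
Arguments interlaced {F} b a n.

Lemma interlaced_bilinear (F : fieldType) b (a : F) n :
  let T := interlaced b a in
  T n.+1 * T n.+4 =
  T n.+2 * T n.+3 + (- 1) * (T n * T n.+3 - T n.+1 * T n.+2).
Proof.
rewrite /interlaced /= !negbK uphalf_half.
by case: (odd n); case: b => /=; ring.
Qed.

Lemma interlaced_const (F : fieldType) b (a : F) n :
  interlaced b a (n.*2 + b) = 1.
Proof. by rewrite /interlaced oddD odd_double oddb eqxx. Qed.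

Lemma interlaced_arith (F : fieldType) b (a : F) n :
  interlaced b a (n.*2 + ~~ b) = a + n%:R * (1 - a).
Proof.
rewrite /interlaced oddD odd_double oddb /=.
by case: b; rewrite /= ?addn0 ?addn1 /= ?doubleK ?uphalf_double.
Qed.

(** The progression equals 1 + m (1 - a) at rank m + 1, and rank 2 is the first
    one allowed by the index n + 4, whence m >= 1.  The zeros therefore do not
    depend on the parity b, and the two exceptional cases give the same fractions
    (n + 1) / n. *)
Lemma interlaced_zero (F : numFieldType) b (a : F) :
  (exists n, interlaced b a n.+4 = 0) <->
  (exists2 n : nat, (1 <= n)%N & a = n.+1%:R / n%:R).
Proof.
split=> [[n]|[[//|n] _ ->]].
  rewrite /interlaced /= !negbK.
  case: eqP => _ /eqP; first by rewrite oner_eq0.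
  move=> /eqP h; exists n./2.+1 => //.
  have n0 : n./2.+1%:R != 0 :> F by rewrite pnatr_eq0.
  apply: (mulIf n0); rewrite divfK // -[RHS]subr0 -h.
  by ring.
exists (n.*2 + ~~ b)%N.
have -> : (n.*2 + ~~ b).+4 = (n.+2.*2 + ~~ b)%N by rewrite !doubleS !addSn.
rewrite interlaced_arith; field.
by rewrite nat1r pnatr_eq0.
Qed.

Section ExceptionalOrbits.
Variables (R : realType) (B : R[i]).
Hypothesis hB : B != 0.

(** For z_{-1} = -1/B the quotients T_n / T_{n+2} of even index are 1, so T is
    constant on even indices; T_1 = - B z_0 must be nonzero. *)
Lemma orbit_prev_exceptional (z0 : R[i]) (z0_neq0 : z0 != 0) :
  let T := interlaced false (- (B * z0)) in
  (forbidden B (z0, - 1 / B) <-> exists n, T n.+4 = 0) /\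
  (~ forbidden B (z0, - 1 / B) -> forall n,
     T n.+3 != 0 /\ solution B (z0, - 1 / B) n%:Z = (- 1) * (T n.+1 / T n.+3) / B).
Proof.
apply: (@tau_forbidden_solution _ B hB _ (- 1) (interlaced false (- (B * z0))));
  last exact: interlaced_bilinear.
- by rewrite /interlaced /= mul0r addr0 oppr_eq0 mulf_neq0.
- by rewrite /interlaced /= oner_eq0.
- by rewrite /interlaced /= mul1r addrC subrK oner_eq0.
- by rewrite /interlaced /=; field.
- by rewrite /interlaced /= mul1r mul0r addr0 [_ + (1 - _)]addrC subrK; field.
Qed.

(** For z_0 = -1/B the parities are exchanged, and T_1 = T_2 = T_3 = 1 are
    nonzero for every z_{-1}. *)
Lemma orbit_exceptional (v : R[i]) :
  let T := interlaced true (- (B * v)) in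
  (forbidden B (- 1 / B, v) <-> exists n, T n.+4 = 0) /\
  (~ forbidden B (- 1 / B, v) -> forall n,
     T n.+3 != 0 /\ solution B (- 1 / B, v) n%:Z = (- 1) * (T n.+1 / T n.+3) / B).
Proof.
apply: (@tau_forbidden_solution _ B hB _ (- 1) (interlaced true (- (B * v))));
  last exact: interlaced_bilinear.
- by rewrite /interlaced /= oner_eq0.
- by rewrite /interlaced /= mul1r addrC subrK oner_eq0.
- by rewrite /interlaced /= oner_eq0.
- by rewrite /interlaced /= mul1r mul0r addr0 [_ + (1 - _)]addrC subrK; field.
- by rewrite /interlaced /=; field.
Qed.

Lemma opp_div_eq (z a : R[i]) : - (B * z) = a <-> z = - 1 / B * a.
Proof. by split=> [<-|->]; field. Qed.

Lemma forbidden_prev_exceptional (z0 : R[i]) : z0 != 0 ->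
  forbidden B (z0, - 1 / B) <->
  exists2 n : nat, (1 <= n)%N & z0 = - 1 / B * (n.+1%:R / n%:R).
Proof.
move=> z00; have [-> _] := orbit_prev_exceptional _ z00.
rewrite interlaced_zero.
by split=> -[n n1 /opp_div_eq h]; exists n.
Qed.

Lemma forbidden_exceptional (v : R[i]) :
  forbidden B (- 1 / B, v) <->
  exists2 n : nat, (1 <= n)%N & v = - 1 / B * (n.+1%:R / n%:R).
Proof.
have [-> _] := orbit_exceptional v.
rewrite interlaced_zero.
by split=> -[n n1 /opp_div_eq h]; exists n.
Qed.

(** Once two consecutive terms vanish the denominator is 1; only the first
    denominator 1 + B z_{-1} can be zero. *)
Lemma state_zero (v : R[i]) n : 1 + B * v != 0 ->
  state B (0, v) n = Some (0, if n is 0%N then v else 0).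
Proof.
move=> v1; elim: n => [//|n IHn]; rewrite /state iterS -/(state B _ n) IHn /=.
rewrite /step /= mulr0 subr0 mul0r.
case: n {IHn} => [|n]; first by rewrite (negbTE v1).
by rewrite mulr0 addr0 oner_eq0.
Qed.

Lemma forbidden_zero (v : R[i]) : forbidden B (0, v) <-> v = - 1 / B.
Proof.
have vE : (v = - 1 / B) <-> 1 + B * v = 0.
  by split=> /eqP h; apply/eqP; move: h; rewrite (add1_eq0 _ _ _ hB).
rewrite vE; split=> [[n]|h]; last first.
  by exists 1%N; rewrite /state /= /step /= h mulr0 subr0 eqxx.
by apply: contraPP => /eqP v1; rewrite state_zero.
Qed.

Lemma solution_zero (v : R[i]) : ~ forbidden B (0, v) ->
  forall n : nat, solution B (0, v) n%:Z = 0.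
Proof.
move=> nF n; rewrite /solution state_zero //.
apply/eqP => h; apply: nF; exists 1%N.
by rewrite /state /= /step /= h mulr0 subr0 eqxx.
Qed.

(** The term 2 / B cancels, and B times the numerator at n is the denominator at
    n + 1. *)
Lemma exceptional_recurrence (x : R[i]) (n : nat) :
  let num (k : nat) := k%:R + 2 + k%:R * B * x + B * x in
  let den (k : nat) := k%:R * B + B + k%:R * B ^+ 2 * x in
  den n != 0 -> den n.+1 != 0 ->
  num n.+1 / den n.+1 - 2 / B =
  - 1 / (2 * B + B ^+ 2 * (num n / den n - 2 / B)).
Proof.
move=> num den d0 d1; rewrite /num /den in d0 d1 *; field.
rewrite hB d0 nat1r d1 /= andbT.
rewrite (_ : _ + _ = B * (n.+1%:R * B + B + n.+1%:R * B ^+ 2 * x)); last by ring.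
exact: mulf_neq0.
Qed.

Lemma solution_prev_exceptional (z0 : R[i]) :
  z0 != 0 -> ~ forbidden B (z0, - 1 / B) ->
  let z := solution B (z0, - 1 / B) in
  [/\ forall n : nat, z (2 * n%:Z + 1) = - 1 / B,
      forall n : nat, (1 <= n)%N ->
        z (2 * n%:Z) = - 1 / (2 * B + B ^+ 2 * z (2 * n%:Z - 2))
    & forall n : nat,
        z (2 * n%:Z) =
          (n%:R + 2 + n%:R * B * z0 + B * z0) /
          (n%:R * B + B + n%:R * B ^+ 2 * z0) - 2 / B].
Proof.
move=> z00 nF z; have [_ /(_ nF) sol] := orbit_prev_exceptional _ z00.
set T := interlaced _ _ in sol.
have Todd n : T n.*2.+1 = - (B * z0) + n%:R * (1 + B * z0).
  by have := interlaced_arith _ false (- (B * z0)) n; rewrite addn1 opprK.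
have Teven n : T n.*2 = 1.
  by have := interlaced_const _ false (- (B * z0)) n; rewrite addn0.
have even_val n : n%:R * B + B + n%:R * B ^+ 2 * z0 != 0 /\
    z (2 * n%:Z) = (n%:R + 2 + n%:R * B * z0 + B * z0) /
                   (n%:R * B + B + n%:R * B ^+ 2 * z0) - 2 / B.
  have [Tn] := sol n.*2.
  rewrite -[n.*2.+3]/(n.+1.*2.+1) !Todd in Tn * => zn.
  have d0 : n%:R * B + B + n%:R * B ^+ 2 * z0 != 0.
    rewrite (_ : _ + _ = B * (- (B * z0) + n.+1%:R * (1 + B * z0))); last by ring.
    exact: mulf_neq0.
  split=> //; rewrite /z -[2 * n%:Z]/(Posz (2 * n)) mul2n zn.
  by field; rewrite nat1r hB d0 Tn.
have odd_val n : z (2 * n%:Z + 1) = - 1 / B.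
  have [_] := sol n.*2.+1.
  rewrite -[n.*2.+4]/(n.+2.*2) -[n.*2.+2]/(n.+1.*2) !Teven => zn.
  by rewrite /z -[2 * n%:Z + 1]/(Posz (2 * n + 1)) mul2n addn1 zn; field.
split=> // [[//|n] _|n]; last by case: (even_val n).
have [d1 ->] := even_val n.+1.
have -> : (2 * n.+1%:Z - 2 = 2 * n%:Z)%R by lia.
have [d0 ->] := even_val n.
exact: exceptional_recurrence.
Qed.

Lemma solution_exceptional (v : R[i]) :
  ~ forbidden B (- 1 / B, v) ->
  let z := solution B (- 1 / B, v) in
  [/\ forall n : nat, z (2 * n%:Z) = - 1 / B,
      forall n : nat,
        z (2 * n%:Z + 1) = - 1 / (2 * B + B ^+ 2 * z (2 * n%:Z - 1))
    & forall n : int, -1 <= n ->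
        z (2 * n + 1) =
          (n%:~R + 3 + n%:~R * B * v + 2 * B * v) /
          (n%:~R * B + 2 * B + n%:~R * B ^+ 2 * v + B ^+ 2 * v)
          - 2 / B].
Proof.
move=> nF z; have [_ /(_ nF) sol] := orbit_exceptional v.
set T := interlaced _ _ in sol.
have Teven n : T n.*2 = - (B * v) + n%:R * (1 + B * v).
  by have := interlaced_arith _ true (- (B * v)) n; rewrite addn0 opprK.
have Todd n : T n.*2.+1 = 1.
  by have := interlaced_const _ true (- (B * v)) n; rewrite addn1.
have even_val n : z (2 * n%:Z) = - 1 / B.
  have [_] := sol n.*2.
  rewrite -[n.*2.+3]/(n.+1.*2.+1) !Todd => zn.
  by rewrite /z -[2 * n%:Z]/(Posz (2 * n)) mul2n zn; field.
(* The index is shifted by one so that n = 0 covers z_{-1}. *)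
have odd_val (n : nat) : n%:R * B + B + n%:R * B ^+ 2 * v != 0 /\
    z (2 * (n%:Z - 1) + 1) = (n%:R + 2 + n%:R * B * v + B * v) /
                   (n%:R * B + B + n%:R * B ^+ 2 * v) - 2 / B.
  case: n => [|n].
    split; first by rewrite !mul0r add0r addr0.
    by rewrite /z /=; field.
  have [Tn] := sol n.*2.+1.
  rewrite -[n.*2.+4]/(n.+2.*2) -[n.*2.+2]/(n.+1.*2) !Teven in Tn * => zn.
  have d0 : n.+1%:R * B + B + n.+1%:R * B ^+ 2 * v != 0.
    rewrite (_ : _ + _ = B * (- (B * v) + n.+2%:R * (1 + B * v))); last by ring.
    exact: mulf_neq0.
  split=> //; have -> : (2 * (n.+1%:Z - 1) + 1 = (n.*2.+1)%:Z)%R by lia.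
  rewrite /z zn.
  by field; rewrite -(natrD _ 2 n) nat1r hB d0 Tn.
split=> // [n|n n1].
  have [d1] := odd_val n.+1; have [d0] := odd_val n.
  have -> : (2 * (n%:Z - 1) + 1 = 2 * n%:Z - 1)%R by lia.
  have -> : (2 * (n.+1%:Z - 1) + 1 = 2 * n%:Z + 1)%R by lia.
  by move=> -> ->; apply: exceptional_recurrence.
have [m ->] : exists m : nat, n = m%:Z - 1 by exists (absz (n + 1)); lia.
have [dm ->] := odd_val m; rewrite intrB -pmulrn.
congr (_ / _ - _); ring.
Qed.
End ExceptionalOrbits.

(** * Orbits on an invariant curve D <> 0 *)
Section GenericOrbits.
Variables (R : realType) (B : R[i]).
Hypothesis hB : B != 0.

(** The initial values of T are found by running the recurrence backwards from
    T_3 = 1 and T_4 = w = (D - 1 - B z_0) / D: this gives T_2 = 1 + B z_0,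
    T_1 = D B z_0 and T_0 = D (D B z_0 - 1 - B z_0), and the relation defining D
    makes c T_0 / T_2 equal to B z_{-1}.  The bilinear identity is a consequence
    of the linear recurrence alone. *)
Lemma generic_orbit (z0 zm1 D : R[i]) :
  z0 != 0 -> z0 != - 1 / B -> D != 0 ->
  D * (B * z0) = (1 + B * z0) * (1 + B * zm1) ->
  let y := linrec D^-1 1 ((D - 1 - B * z0) / D) in
  (forbidden B (z0, zm1) <-> exists n, y n.+1 = 0) /\
  (~ forbidden B (z0, zm1) -> forall n,
     y n != 0 /\ B * solution B (z0, zm1) n%:Z = D - 1 - D * (y n.+1 / y n)).
Proof.
move=> z00; rewrite -(add1_eq0 _ _ _ hB) => z1 D0 DE y.
pose T := linrec D^-1 (D * (D * (B * z0) - 1 - B * z0)) (D * (B * z0)).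
have T2 : T 2%N = 1 + B * z0 by rewrite /T /=; field.
have T3 : T 3%N = 1 by rewrite -[T 3%N]/(T 2%N - D^-1 * T 1%N) T2 /T /=; field.
have T4 : T 4%N = (D - 1 - B * z0) / D.
  by rewrite -[T 4%N]/(T 3%N - D^-1 * T 2%N) T2 T3; field.
have yT n : T n.+3 = y n.
  by rewrite -[LHS]/(linrec D^-1 (T 3%N) (T 4%N) n) T3 T4.
have Trec n : T n.+2 = T n.+1 - D^-1 * T n by exact: linrecSS.
have [] := @tau_forbidden_solution _ B hB (z0, zm1) D^-1 T.
- by rewrite /T /= !mulf_neq0 //.
- by rewrite T2.
- by rewrite T3 oner_eq0.
- by rewrite T2 /T /= DE; field; rewrite z1 D0.
- by rewrite T3 /T /=; field.
- by move=> n; rewrite !Trec; ring.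
move=> forbE sol; split.
  by rewrite forbE; split=> -[n Tn]; exists n; rewrite -?yT // yT.
move=> nF n; have [Tn zn] := sol nF n; split; first by rewrite -yT.
rewrite zn -!yT mulrC divfK // !Trec; rewrite !Trec in Tn; field.
rewrite D0 (_ : _ - _ = D * (T n.+1 - D^-1 * T n - D^-1 * T n.+1)) ?mulf_neq0 //.
by field.
Qed.

(** Away from 0 and -1/B, these are the first coordinates a of the forbidden
    points on the curve of invariant D ([forbidden_fiber]). *)
Definition breakdown (D a : R[i]) : Prop :=
  exists n, linrec D^-1 0 1 n.+1 != 0 /\
            B * a = D - 1 - linrec D^-1 0 1 n / linrec D^-1 0 1 n.+1.

Lemma forbidden_generic (z0 zm1 D : R[i]) :
  z0 != 0 -> z0 != - 1 / B -> D != 0 ->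
  D * (B * z0) = (1 + B * z0) * (1 + B * zm1) ->
  forbidden B (z0, zm1) <-> breakdown D z0.
Proof.
move=> z00 z1 D0 DE; have [-> _] := generic_orbit _ _ _ z00 z1 D0 DE.
rewrite linrec_zero ?invr_neq0 //.
split=> -[n [Un wE]]; exists n; split=> //.
  have -> : B * z0 = D - 1 - D * ((D - 1 - B * z0) / D) by field.
  by rewrite wE mulVKf.
by rewrite wE; field; rewrite ?D0 ?Un.
Qed.

(** The second coordinate solves the equation of the invariant curve for
    z_{-1}. *)
Lemma forbidden_fiber (D a : R[i]) : D != 0 -> a != 0 -> a != - 1 / B ->
  forbidden B (a, (D * B * a - B * a - 1) / (B ^+ 2 * a + B)) <-> breakdown D a.
Proof.
move=> D0 a0 a1; apply: forbidden_generic => //.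
move: a1; rewrite -(add1_eq0 _ _ _ hB) => a1; field.
by rewrite (_ : _ + _ = B * (1 + B * a)) ?mulf_neq0 //; ring.
Qed.

Lemma solution_generic (z0 zm1 D : R[i]) (f : nat -> R[i]) :
  z0 != 0 -> z0 != - 1 / B -> D != 0 ->
  D * (B * z0) = (1 + B * z0) * (1 + B * zm1) ->
  ~ forbidden B (z0, zm1) ->
  f 0%N != 0 -> f 1%N = (D - 1 - B * z0) / D * f 0%N ->
  (forall n, f n.+2 = f n.+1 - D^-1 * f n) ->
  forall n, solution B (z0, zm1) n%:Z = (D - 1 - D * (f n.+1 / f n)) / B.
Proof.
move=> z00 z1 D0 DE nF f0 f1 frec n.
have [_ /(_ nF n) [_ zn]] := generic_orbit _ _ _ z00 z1 D0 DE.
by rewrite (linrec_ratio _ D^-1 _ f0 frec) f1 mulfK // -zn mulrAC mulfV // mul1r.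
Qed.

Lemma solution_generic_neq0 (z0 zm1 D : R[i]) (f : nat -> R[i]) :
  z0 != 0 -> z0 != - 1 / B -> D != 0 ->
  D * (B * z0) = (1 + B * z0) * (1 + B * zm1) ->
  ~ forbidden B (z0, zm1) ->
  f 0%N != 0 -> f 1%N = (D - 1 - B * z0) / D * f 0%N ->
  (forall n, f n.+2 = f n.+1 - D^-1 * f n) ->
  forall n, f n != 0.
Proof.
move=> z00 z1 D0 DE nF f0 f1 frec n.
have [_ /(_ nF n) [yn _]] := generic_orbit _ _ _ z00 z1 D0 DE.
rewrite (linrec_eq _ _ _ frec) f1 mulrC -{1}[f 0%N]mulr1 linrecZ.
exact: mulf_neq0.
Qed.

Lemma solution_step (z0 zm1 D : R[i]) :
  z0 != 0 -> z0 != - 1 / B -> D != 0 ->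
  D * (B * z0) = (1 + B * z0) * (1 + B * zm1) ->
  ~ forbidden B (z0, zm1) -> let z := solution B (z0, zm1) in
  forall n : nat,
  z (n%:Z + 1) = (1 + B * z n%:Z) / (D * B - B - B ^+ 2 * z n%:Z).
Proof.
move=> z00 z1 D0 DE nF z n.
have [_ /(_ nF) sol] := generic_orbit _ _ _ z00 z1 D0 DE.
set y := linrec _ _ _ in sol.
have [yn zn] := sol n; have [yn1 zn1] := sol n.+1.
have yrec m : y m.+2 = y m.+1 - D^-1 * y m by exact: linrecSS.
rewrite -[n%:Z + 1]/(Posz (n + 1)) addn1 expr2 -mulrA -/z in zn zn1 *.
rewrite zn; apply: (mulfI hB); rewrite zn1 yrec; field.
rewrite yn yn1 D0 (_ : _ + _ = B * (D * y n.+1)) ?mulf_neq0 //.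
by ring.
Qed.

(** [breakdown] only involves ratios of U, so U may be replaced by any of its
    nonzero multiples f. *)
Lemma breakdown_via (D a : R[i]) (f : nat -> R[i]) :
  f 0%N = 0 -> f 1%N != 0 -> (forall n, f n.+2 = f n.+1 - D^-1 * f n) ->
  breakdown D a <->
  exists n, f n.+1 != 0 /\ a = (D - 1 - f n / f n.+1) / B.
Proof.
move=> f0 f1 frec.
split=> -[n [fn aE]]; have [UE ratio] := linrec01_ratio _ _ _ f0 f1 frec n.
  exists n; split; first by rewrite -UE.
  by rewrite -ratio -aE mulrAC mulfV // mul1r.
by exists n; split; rewrite ?UE // ratio aE mulrC divfK.
Qed.

End GenericOrbits.
Arguments breakdown {R} B D a.

(** * The forbidden set *)
Section ForbiddenSet.
Variables (R : realType) (B : R[i]).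
Hypothesis hB : B != 0.

(** Here f is a multiple of U written with the roots (1 +- s)/2; the powers of 2
    in f_n / f_{n+1} produce the factor 2 of P_D. *)
Lemma P_set_breakdown (D a : R[i]) : ~ real_axis `[0, 4] D ->
  P_set B D a <-> breakdown B D a.
Proof.
move=> nD; pose s := sqrtc (1 - 4 / D).
have sE : s ^+ 2 = 1 - 4 / D by apply: sqr_sqrtc.
have D0 : D != 0.
  by apply/eqP => D0; apply: nD; rewrite D0; exists 0; rewrite //= in_itv /=; lra.
pose f n := 1 * ((1 + s) / 2) ^+ n + (- 1) * ((1 - s) / 2) ^+ n.
have fE n : f n = ((1 + s) ^+ n - (1 - s) ^+ n) / 2 ^+ n.
  by rewrite /f !expr_div_n; ring.
have pow2 n : 2 ^+ n != 0 :> R[i] by rewrite expf_neq0 // pnatr_eq0.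
have f_neq0 n : f n.+1 != 0.
  by rewrite fE mulf_neq0 ?invr_eq0 // (expr_add1_sub1 _ _ _ _ nD sE).
rewrite (breakdown_via _ _ hB _ _ f) //; last first.
- by apply: root_pair_rec; rewrite expr_div_n; [rewrite sqrrD | rewrite sqrrB];
    rewrite sE; field; exact: D0.
- by rewrite fE !expr0 subrr mul0r.
have val n : - 2 / B * (((1 + s) ^+ n - (1 - s) ^+ n) /
                  ((1 + s) ^+ n.+1 - (1 - s) ^+ n.+1)) + (D - 1) / B =
             (D - 1 - f n / f n.+1) / B.
  have nz := expr_add1_sub1 _ _ _ n nD sE.
  rewrite !fE [2 ^+ n.+1]exprS; move: nz.
  set x := (_ - _ in X in X -> _); set y := (1 + s) ^+ n - _.
  by move=> nz; field; rewrite hB nz pow2.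
split=> [[[//|n] _ <-]|[n [_ ->]]].
  by exists n; split=> //; rewrite -val -/s subn1.
by exists n.+1 => //; rewrite -/s subn1 val.
Qed.

(** Expanding sin (n rho) = sin ((n + 1) rho - rho) turns the ratio
    f_n / f_{n+1} into an affine function of the cotangent; the multiples of pi
    removed from Q_D are the indices at which U vanishes. *)
Lemma Q_set_breakdown (t : R) (a : R[i]) : 0 < t < 4 ->
  Q_set B t a <-> breakdown B t%:C a.
Proof.
move=> t04; have [cosE sinE] := cos_acos_sqrt _ _ t04.
set rho := acos _ in cosE sinE.
have /andP[t0 t4] := t04.
have s0 : 0 < Num.sqrt t by rewrite sqrtr_gt0.
have s2 : Num.sqrt t ^+ 2 = t by rewrite sqr_sqrtr // ltW.
have q0 : 0 < Num.sqrt (4 / t - 1).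
  by rewrite sqrtr_gt0 subr_gt0 ltr_pdivlMr // mul1r.
have sin_rho : sin rho != 0.
  by rewrite sinE cosE mulf_neq0 ?gt_eqF // divr_gt0.
pose g (n : nat) : R := sin (n%:R * rho) / Num.sqrt t ^+ n.
pose f (n : nat) : R[i] := (g n)%:C.
have f_eq0 n : (f n == 0) = (sin (n%:R * rho) == 0).
  rewrite /f fmorph_eq0 /g mulf_eq0 invr_eq0 expf_eq0 (gt_eqF s0) andbF orbF //.
rewrite (breakdown_via _ _ hB _ _ f); last first.
- move=> n; have := trig_rec _ _ 0 1 t04 n; rewrite -/rho !mul0r !add0r !mul1r.
  by rewrite /f /g -!rmorphXn -!fmorph_div /=.
- by rewrite f_eq0 mul1r.
- by apply/eqP; rewrite f_eq0 mul0r sin0.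
have val n : f n.+1 != 0 ->
    - t%:C / (2 * B) * (1 - (Num.sqrt (4 / t - 1))%:C * (cot (n.+1%:R * rho))%:C)
       + (t%:C - 1) / B = (t%:C - 1 - f n / f n.+1) / B.
  rewrite f_eq0 => sn.
  have -> : f n / f n.+1 =
      (t / 2 * (1 - Num.sqrt (4 / t - 1) * cot (n.+1%:R * rho)))%:C.
    rewrite /f -fmorph_div /=; congr (_ %:C); rewrite /g exprS /cot.
    have -> : n%:R * rho = n.+1%:R * rho - rho by ring.
    rewrite sinB sinE cosE; rewrite -[X in _ = X / 2 * _]s2.
    by field; rewrite sn expf_neq0 gt_eqF.
  by field.
have sinP n : f n.+1 != 0 <-> ~ exists k : int, n.+1%:R * rho = k%:~R * pi.
  by rewrite -sin_eq0 f_eq0; split=> /eqP.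
split=> [[[|n] [//] _ kn <-]|[n [fn ->]]].
  have fn : f n.+1 != 0 by apply/sinP.
  by exists n; split=> //; rewrite -val.
by exists n.+1; [split=> //; apply/sinP | rewrite val].
Qed.

Lemma double_root_breakdown (a : R[i]) :
  [set - 2 / B * ((n%:R - 1) / n%:R) + 3 / B
               | n in [set n : nat | (1 <= n)%N]] a <-> breakdown B 4 a.
Proof.
pose f (n : nat) : R[i] := (0 + 1 * n%:R) / 2 ^+ n.
have pow2 n : 2 ^+ n != 0 :> R[i] by rewrite expf_neq0 // pnatr_eq0.
have f_neq0 n : f n.+1 != 0.
  by rewrite /f add0r mul1r mulf_neq0 ?invr_eq0 // pnatr_eq0.
rewrite (breakdown_via _ _ hB _ _ f) //; last first.
- exact: double_root_rec.
- by rewrite /f add0r mul1r mul0r.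
have val n : - 2 / B * ((n.+1%:R - 1) / n.+1%:R) + 3 / B =
             (4 - 1 - f n / f n.+1) / B.
  rewrite /f exprS; field.
  by rewrite hB pow2 nat1r pnatr_eq0.
split=> [[[//|n] _ <-]|[n [_ ->]]].
  by exists n; split=> //; rewrite val.
by exists n.+1; rewrite //= val.
Qed.

(** Each piece of S_1 lies over one type of initial condition.  A forbidden point
    with z_0 <> 0 and no coordinate equal to -1/B has an invariant D <> 0, and
    either D lies outside [0, 4], or D = 4, or D lies in (0, 4). *)
Lemma forbidden_S1 : forbidden B = S1 B.
Proof.
apply/seteqP; split=> [[z0 zm1]|p]; last first.
  move=> [[[[[|]|]|]|]|].
  - by move=> ->; apply/forbidden_zero.
  - move=> [n n1 <-]; apply/forbidden_prev_exceptional => //; last by exists n.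
    rewrite mulf_neq0 // mulf_neq0 ?invr_eq0 ?oppr_eq0 ?oner_eq0 ?pnatr_eq0 //.
    by rewrite -lt0n.
  - by move=> [n n1 <-]; apply/forbidden_exceptional => //; exists n.
  - move=> [D /= nD] [a [aP /not_orP[/eqP a0 /eqP a1]] <-].
    apply/forbidden_fiber => //; last exact/P_set_breakdown.
    by apply/eqP => D0; apply: nD; rewrite D0; exists 0; rewrite //= in_itv /=; lra.
  - move=> [t /= t04] [a [aQ /not_orP[/eqP a0 /eqP a1]] <-].
    rewrite in_itv /= in t04; have /andP[t0 _] := t04.
    apply/forbidden_fiber => //; last exact/Q_set_breakdown.
    by rewrite fmorph_eq0 gt_eqF.
  - move=> [a [aQ /not_orP[/eqP a0 /eqP a1]] <-].
    have -> : 3 * B * a - 1 = 4 * B * a - B * a - 1 by ring.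
    by apply/forbidden_fiber => //; last exact/double_root_breakdown.
have [->|z00] := eqVneq z0 0.
  by move=> /(forbidden_zero _ _ hB) ->; do 5!left.
have [->|z1] := eqVneq z0 (- 1 / B).
  by move=> /(forbidden_exceptional _ _ hB) [n n1 ->]; do 3!left; right; exists n.
have [->|zm11] := eqVneq zm1 (- 1 / B).
  move=> /(forbidden_prev_exceptional _ _ hB _ z00) [n n1 ->].
  by do 4!left; right; exists n.
pose D := (1 + B * z0) * (1 + B * zm1) / (B * z0).
have Bz0 : B * z0 != 0 by rewrite mulf_neq0.
have D0 : D != 0 by rewrite !mulf_neq0 ?invr_eq0 ?(add1_eq0 _ _ _ hB).
have DE : D * (B * z0) = (1 + B * z0) * (1 + B * zm1) by rewrite divfK.
have zm1E : zm1 = (D * B * z0 - B * z0 - 1) / (B ^+ 2 * z0 + B).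
  have nz : B ^+ 2 * z0 + B != 0.
    by rewrite (_ : _ + _ = B * (1 + B * z0)) ?mulf_neq0 ?(add1_eq0 _ _ _ hB) //; ring.
  by apply: (mulIf nz); rewrite divfK // -[D * B * z0]mulrA DE; ring.
have nspecial : ~ [set 0; - 1 / B] z0 by move=> [] /eqP; apply/negP.
rewrite (forbidden_generic _ _ hB _ _ _ z00 z1 D0 DE) => fat.
have [[t t04 tD]|nD] := pselect (real_axis `[0, 4] D); last first.
  left; left; right; exists D => //.
  by exists z0; [split=> //; apply/P_set_breakdown | rewrite zm1E].
rewrite /= in_itv /= in t04.
have [t4|t4] := eqVneq t 4.
  right; have D4 : D = 4 by rewrite -tD t4 rmorph_nat.
  exists z0; first by split=> //; apply/double_root_breakdown; rewrite -D4.
  by rewrite zm1E D4; congr (_, _ / _); ring.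
left; right; have t04' : 0 < t < 4.
  have t0 : t != 0 by apply: contra_neq D0 => t0; rewrite -tD t0.
  by rewrite !lt_neqAle eq_sym t0 t4.
exists t; first by rewrite /= in_itv.
exists z0; last by rewrite zm1E -tD.
by split=> //; apply/Q_set_breakdown => //; rewrite tD.
Qed.
End ForbiddenSet.

(** * Closed forms on an invariant curve *)
Section ClosedForms.
Variables (R : realType) (B z0 zm1 D : R[i]).
Hypotheses (hB : B != 0) (z0_neq0 : z0 != 0) (z0_regular : z0 != - 1 / B).
Hypotheses (D_neq0 : D != 0)
  (DE : D * (B * z0) = (1 + B * z0) * (1 + B * zm1)).
Hypothesis not_forbidden : ~ forbidden B (z0, zm1).
Let z : int -> R[i] := solution B (z0, zm1).
Let C : R[i] := D * B.

Let sol f :=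
  solution_generic _ _ hB _ _ _ f z0_neq0 z0_regular D_neq0 DE not_forbidden.

(** M_2 and M_1 are the coordinates of the orbit on the powers of l1 and l2, up to
    the common factor C (l2 - l1), which is nonzero because D <> 4. *)
Lemma solution_roots :
  ~ real_axis `[1 / 4, +oo[ (B / C) ->
  let l1 : R[i] := (1 - sqrtc (1 - 4 * B / C)) / 2 in
  let l2 : R[i] := (1 + sqrtc (1 - 4 * B / C)) / 2 in
  let M1 : R[i] := C - B - B ^+ 2 * z0 - C * l1 in
  let M2 : R[i] := C * l2 + B + B ^+ 2 * z0 - C in
  forall n : nat,
    z n%:Z = - C / B ^+ 2 * ((M2 * l1 ^+ n.+1 + M1 * l2 ^+ n.+1) /
                             (M2 * l1 ^+ n + M1 * l2 ^+ n))
             + C / B ^+ 2 - 1 / B.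
Proof.
have CD : 4 * B / C = 4 / D by rewrite /C; field; rewrite hB D_neq0.
rewrite CD => nD l1 l2 M1 M2 n; pose s := sqrtc (1 - 4 / D).
have s2 : s ^+ 2 = 1 - 4 / D by apply: sqr_sqrtc.
have s0 : s != 0.
  (* s = 0 would mean D = 4, that is B / C = 1/4. *)
  rewrite -[_ == 0]/(s == 0) -sqrf_eq0 s2; apply/eqP => /subr0_eq D4.
  have {}D4 : D = 4 by rewrite -[LHS]mul1r [X in X * _]D4 divfK.
  apply: nD; exists (1 / 4); first by rewrite /= in_itv /= lexx.
  rewrite fmorph_div rmorph1 rmorph_nat /C D4; field.
  exact: hB.
pose f k := M2 * l1 ^+ k + M1 * l2 ^+ k.
rewrite -[M2 * l1 ^+ n + _]/(f n) -[M2 * l1 ^+ n.+1 + _]/(f n.+1).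
rewrite [LHS](sol f).
- by rewrite /C; set r := _ / f n; field.
- rewrite /f !expr0 !mulr1 (_ : _ + _ = C * s) ?mulf_neq0 //.
  by rewrite /M1 /M2 /l1 /l2 -/s; field.
- by rewrite /f !expr0 !expr1 /M1 /M2 /l1 /l2 -/s /C; field.
- by apply: root_pair_rec; rewrite /l1 /l2 -/s expr_div_n ?sqrrB ?sqrrD s2;
    field.
Qed.

Lemma solution_double_root : C = 4 * B ->
  forall n : nat,
    z n%:Z = (4 + (n%:R + 1) * (2 - 2 * B * z0)) /
             (n%:R * B ^+ 2 * z0 - 2 * B - n%:R * B) + 3 / B.
Proof.
move=> /(mulIf hB) D4 n.
pose f (k : nat) := (2 + (1 - B * z0) * k%:R) / 2 ^+ k.
have pow2 k : 2 ^+ k != 0 :> R[i] by rewrite expf_neq0 // pnatr_eq0.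
have f0 : f 0%N != 0.
  by rewrite /f mulr0 addr0 expr0 divr1 pnatr_eq0.
have f1 : f 1%N = (D - 1 - B * z0) / D * f 0%N.
  by rewrite /f D4; field.
have frec : forall k, f k.+2 = f k.+1 - D^-1 * f k.
  by rewrite D4; apply: double_root_rec.
have fn : f n != 0.
  exact: (solution_generic_neq0 _ _ hB _ _ _ f z0_neq0 z0_regular D_neq0 DE).
rewrite [LHS](sol f) // D4 /f exprS.
have nz : 2 + (1 - B * z0) * n%:R != 0.
  by apply: contra_neq fn => nz; rewrite /f nz mul0r.
field.
rewrite hB pow2 nz (_ : _ - _ = - B * (2 + (1 - B * z0) * n%:R)); last by ring.
by rewrite mulf_neq0 ?oppr_eq0.
Qed.

(** The powers of sqrt(D) in the trigonometric solution contribute a factor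
    1 / sqrt(D) to each ratio, and D / sqrt(D) = sqrt(D) is the factor in front of
    the formula.  The value at n = 1 is right because sin rho = s cos rho. *)
Lemma solution_trig : real_axis `]0, 4[ (C / B) ->
  let rho : R := acos (complex.Re (sqrtc (C / (4 * B)))) in
  let w0 : R[i] := (- B ^+ 2 * z0 + C - B) / C in
  let s : R[i] := sqrtc (4 * B / C - 1) in
  forall n : nat,
    z n%:Z =
      - sqrtc (C / B) / B *
        ((s * (cos (n.+1%:R * rho))%:C
          + (2 * w0 - 1) * (sin (n.+1%:R * rho))%:C) /
         (s * (cos (n%:R * rho))%:C
          + (2 * w0 - 1) * (sin (n%:R * rho))%:C))
      + (C - B) / B ^+ 2.
Proof.
move=> [t t04]; rewrite {1}/C mulfK // => tD rho w0 s n.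
rewrite /= in_itv /= in t04; have /andP[t0 t4] := t04.
have st0 : 0 < Num.sqrt t by rewrite sqrtr_gt0.
have st2 : Num.sqrt t ^+ 2 = t by rewrite sqr_sqrtr // ltW.
have sqrtc_real (x : R) : 0 <= x -> sqrtc x%:C = (Num.sqrt x)%:C.
  by move=> x0; rewrite sqrtc_sqrtr // ler0c.
have rhoE : rho = acos (Num.sqrt t / 2).
  rewrite /rho; congr acos.
  have -> : C / (4 * B) = ((Num.sqrt t / 2) ^+ 2)%:C.
    by rewrite /C expr_div_n st2 -tD; field.
  by rewrite sqrtc_real ?sqr_ge0 //= sqrtr_sqr ger0_norm // ltW // divr_gt0.
have sE : s = (Num.sqrt (4 / t - 1))%:C.
  rewrite /s -sqrtc_real; last by rewrite subr_ge0 ler_pdivlMr // mul1r ltW.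
  congr sqrtc; rewrite /C -tD; field.
  by rewrite hB ?fmorph_eq0 gt_eqF.
have sqrtD : sqrtc D = (Num.sqrt t)%:C by rewrite -tD sqrtc_real // ltW.
have [cosE sinE] := cos_acos_sqrt _ _ t04.
pose g (k : nat) := s * (cos (k%:R * rho))%:C + (2 * w0 - 1) * (sin (k%:R * rho))%:C.
pose f k := g k / (Num.sqrt t)%:C ^+ k.
rewrite -/(g n) -/(g n.+1) sqrtD.
have st0c : (Num.sqrt t)%:C != 0 :> R[i] by rewrite fmorph_eq0 gt_eqF.
rewrite [LHS](sol f).
- have -> : f n.+1 / f n = g n.+1 / g n / (Num.sqrt t)%:C.
    rewrite /f exprS invf_div; move: (g n)^-1 => r; field.
    by rewrite st0c expf_neq0.
  have Dq : D = (Num.sqrt t)%:C ^+ 2 by rewrite -tD -rmorphXn /= st2.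
  move: (g n.+1 / g n) => r; rewrite /C Dq; field.
  by rewrite st0c hB.
- rewrite /f /g !mul0r cos0 sin0 expr0 divr1 mulr0 addr0 mulr1 sE fmorph_eq0.
  by rewrite gt_eqF // sqrtr_gt0 subr_gt0 ltr_pdivlMr // mul1r.
- rewrite /f /g !mul0r cos0 sin0 expr0 divr1 mulr0 addr0 mulr1 !mul1r expr1.
  rewrite rhoE sinE cosE sE /w0 /C.
  by field; rewrite ?hB ?D_neq0 ?st0c ?fmorph_eq0 ?gt_eqF.
- by rewrite /f /g rhoE -tD; apply: trig_rec.
Qed.
End ClosedForms.

(** * The theorem *)

Theorem theorem2 (R : realType) (B : R[i]) (hB : B != 0) :
  forbidden B = S1 B /\
  (forall z0 zm1 : R[i], ~ forbidden B (z0, zm1) ->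
   let z : int -> R[i] := solution B (z0, zm1) in
   (* the four possibilities are exhaustive *)
   [\/ z0 = 0,
       z0 <> 0 /\ zm1 = - 1 / B,
       z0 = - 1 / B
     | [/\ z0 <> 0, z0 <> - 1 / B & zm1 <> - 1 / B]] /\
   (* (i) *)
   (z0 = 0 -> forall n : nat, z n%:Z = 0) /\
   (* (ii) *)
   (z0 <> 0 -> zm1 = - 1 / B ->
    [/\ forall n : nat, z (2 * n%:Z + 1) = - 1 / B,
        forall n : nat, (1 <= n)%N ->
          z (2 * n%:Z) = - 1 / (2 * B + B ^+ 2 * z (2 * n%:Z - 2))
      & forall n : nat,
          z (2 * n%:Z) =
            (n%:R + 2 + n%:R * B * z0 + B * z0) /
            (n%:R * B + B + n%:R * B ^+ 2 * z0) - 2 / B]) /\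
   (* (iii) *)
   (z0 = - 1 / B ->
    [/\ forall n : nat, z (2 * n%:Z) = - 1 / B,
        forall n : nat,
          z (2 * n%:Z + 1) = - 1 / (2 * B + B ^+ 2 * z (2 * n%:Z - 1))
      & forall n : int, -1 <= n ->
          z (2 * n + 1) =
            (n%:~R + 3 + n%:~R * B * zm1 + 2 * B * zm1) /
            (n%:~R * B + 2 * B + n%:~R * B ^+ 2 * zm1 + B ^+ 2 * zm1)
            - 2 / B]) /\
   (* (iv) *)
   (z0 <> 0 -> z0 <> - 1 / B -> zm1 <> - 1 / B ->
    let C : R[i] := (1 / z0 + B) * (1 + B * zm1) in
    [/\ forall n : nat,
          z (n%:Z + 1) = (1 + B * z n%:Z) / (C - B - B ^+ 2 * z n%:Z),
        (* (a) *)
        ~ real_axis `[1 / 4, +oo[ (B / C) ->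
        let l1 : R[i] := (1 - sqrtc (1 - 4 * B / C)) / 2 in
        let l2 : R[i] := (1 + sqrtc (1 - 4 * B / C)) / 2 in
        let M1 : R[i] := C - B - B ^+ 2 * z0 - C * l1 in
        let M2 : R[i] := C * l2 + B + B ^+ 2 * z0 - C in
        forall n : nat,
          z n%:Z =
            - C / B ^+ 2 * ((M2 * l1 ^+ n.+1 + M1 * l2 ^+ n.+1) /
                            (M2 * l1 ^+ n + M1 * l2 ^+ n))
            + C / B ^+ 2 - 1 / B,
        (* (b) *)
        C = 4 * B ->
        forall n : nat,
          z n%:Z =
            (4 + (n%:R + 1) * (2 - 2 * B * z0)) /
            (n%:R * B ^+ 2 * z0 - 2 * B - n%:R * B) + 3 / B
      & (* (c) *)
        real_axis `]0, 4[ (C / B) ->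
        let rho : R := acos (complex.Re (sqrtc (C / (4 * B)))) in
        let w0 : R[i] := (- B ^+ 2 * z0 + C - B) / C in
        let s : R[i] := sqrtc (4 * B / C - 1) in
        forall n : nat,
          z n%:Z =
            - sqrtc (C / B) / B *
              ((s * (cos (n.+1%:R * rho))%:C
                + (2 * w0 - 1) * (sin (n.+1%:R * rho))%:C) /
               (s * (cos (n%:R * rho))%:C
                + (2 * w0 - 1) * (sin (n%:R * rho))%:C))
            + (C - B) / B ^+ 2])).
Proof.
split=> [|z0 zm1 nF z]; first exact: forbidden_S1.
have case4 : [\/ z0 = 0, z0 <> 0 /\ zm1 = - 1 / B, z0 = - 1 / B
     | [/\ z0 <> 0, z0 <> - 1 / B & zm1 <> - 1 / B]].
  have [?|?] := pselect (z0 = 0); first by constructor 1.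
  have [?|?] := pselect (zm1 = - 1 / B); first by constructor 2.
  have [?|?] := pselect (z0 = - 1 / B); first by constructor 3.
  by constructor 4.
split=> {case4} //; split; last split; last split.
- move=> z00; rewrite /z z00; apply: solution_zero; by rewrite // -z00.
- move=> /eqP z00 zm1E; rewrite /z zm1E; apply: solution_prev_exceptional => //.
  by rewrite -zm1E.
- move=> z0E; rewrite /z z0E; apply: solution_exceptional => //; by rewrite -z0E.
move=> /eqP z00 /eqP z0p /eqP zm1p C.
pose D := (1 + B * z0) * (1 + B * zm1) / (B * z0).
have Bz0 : B * z0 != 0 by rewrite mulf_neq0.
have D0 : D != 0 by rewrite !mulf_neq0 ?invr_eq0 ?(add1_eq0 _ _ _ hB).
have DE : D * (B * z0) = (1 + B * z0) * (1 + B * zm1) by rewrite divfK.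
have -> : C = D * B.
  by rewrite /C /D; field; rewrite hB z00.
split.
- exact: (solution_step _ _ hB _ _ _ z00 z0p D0 DE nF).
- exact: (solution_roots _ _ _ _ _ hB z00 z0p D0 DE nF).
- exact: (solution_double_root _ _ _ _ _ hB z00 z0p D0 DE nF).
- exact: (solution_trig _ _ _ _ _ hB z00 z0p D0 DE nF).
Qed.
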